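(* Let $\mathcal{P}$ be a finite set of propositional symbols and $\varphi$ an $\mathrm{LDL}_f$ formula over $\mathcal{P}$. Let $\mathsf{pref}_{\varphi}$ and $\mathsf{pref}_{\neg\varphi}$ be regular expressions over $2^{\mathcal{P}}$ (built from propositional formulae with $+$, $;$, $^*$, without tests) with $\mathcal{L}(\mathsf{pref}_{\varphi})=\mathcal{L}_{\mathit{poss\_good}}(\varphi)$ and $\mathcal{L}(\mathsf{pref}_{\neg\varphi})=\mathcal{L}_{\mathit{poss\_good}}(\neg\varphi)$. Then for every finite trace $\pi$: (1) $\varphi$ is in RV state $\mathit{temp\_true}$ on $\pi$ iff $\pi\models\varphi\wedge\langle\mathsf{pref}_{\neg\varphi}\rangle\mathit{end}$; (2) $\varphi$ is in RV state $\mathit{temp\_false}$ on $\pi$ iff $\pi\models\neg\varphi\wedge\langle\mathsf{pref}_{\varphi}\rangle\mathit{end}$; (3) $\varphi$ is in RV state $\mathit{perm\_true}$ on $\pi$ iff $\pi\models\langle\mathsf{pref}_{\varphi}\rangle\mathit{end}\wedge\neg\langle\mathsf{pref}_{\neg\varphi}\rangle\mathit{end}$; (4) $\varphi$ is in RV state $\mathit{perm\_false}$ on $\pi$ iff $\pi\models\langle\mathsf{pref}_{\neg\varphi}\rangle\mathit{end}\wedge\neg\langle\mathsf{pref}_{\varphi}\rangle\mathit{end}$.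
   Context: A trace is a finite, possibly empty, sequence $\pi=\pi_0,\dots,\pi_n$ of elements of $2^{\mathcal{P}}$; $\mathit{length}(\pi)=n+1$ ($0$ for the empty trace $\epsilon$), $\pi(i)=\pi_i$, and $\pi(i,j)=\pi_i,\dots,\pi_{j-1}$ (equal to $\pi(i,\mathit{length}(\pi))$ if $j>\mathit{length}(\pi)$, and to $\epsilon$ if $j\le i$). $\pi\pi'$ denotes concatenation of traces. $\mathrm{LDL}_f$ formulae and path expressions are given by $\varphi ::= \mathtt{true}\mid\mathtt{false}\mid\neg\varphi\mid\varphi_1\wedge\varphi_2\mid\varphi_1\vee\varphi_2\mid\langle\rho\rangle\varphi\mid[\rho]\varphi$ and $\rho ::= \phi\mid\varphi?\mid\rho_1+\rho_2\mid\rho_1;\rho_2\mid\rho^*$, where $\phi$ ranges over propositional formulae over $\mathcal{P}$. Semantics at position $i\ge 0$: $\pi,i\models\mathtt{true}$; $\pi,i\not\models\mathtt{false}$; Boolean connectives as usual; $\pi,i\models\langle\rho\rangle\varphi$ iff for some $j\ge i$, $\pi(i,j)\in\mathcal{L}(\rho)$ and $\pi,j\models\varphi$; $\pi,i\models[\rho]\varphi$ iff for all $j\ge i$ with $\pi(i,j)\in\mathcal{L}(\rho)$, $\pi,j\models\varphi$. Here $\pi(i,j)\in\mathcal{L}(\phi)$ iff $j=i+1$, $i<\mathit{length}(\pi)$ and $\pi(i)\models\phi$; $\pi(i,j)\in\mathcal{L}(\varphi?)$ iff $j=i$ and $\pi,i\models\varphi$; $\pi(i,j)\in\mathcal{L}(\rho_1+\rho_2)$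 iff it is in $\mathcal{L}(\rho_1)$ or $\mathcal{L}(\rho_2)$; $\pi(i,j)\in\mathcal{L}(\rho_1;\rho_2)$ iff for some $k$, $\pi(i,k)\in\mathcal{L}(\rho_1)$ and $\pi(k,j)\in\mathcal{L}(\rho_2)$; $\pi(i,j)\in\mathcal{L}(\rho^* )$ iff $j=i$ or for some $k$, $\pi(i,k)\in\mathcal{L}(\rho)$ and $\pi(k,j)\in\mathcal{L}(\rho^* )$. We write $\pi\models\varphi$ for $\pi,0\models\varphi$, and $\mathcal{L}(\varphi)=\{\pi\mid\pi\models\varphi\}$. The abbreviation $\mathit{end}$ stands for $[\mathit{true}]\mathtt{false}$ ($\mathit{true}$ the propositional tautology). For a test-free regular expression $\rho$, $\mathcal{L}(\rho)$ also denotes its usual language of finite traces (a propositional formula $\phi$ matches the one-letter traces $\Pi$ with $\Pi\models\phi$). $\mathcal{L}_{\mathit{poss\_good}}(\varphi)=\{\pi\mid \exists\pi'.\ \pi\pi'\in\mathcal{L}(\varphi)\}$ ($\pi'$ ranges over finite traces, including $\epsilon$). RV states: $\varphi$ is in state $\mathit{temp\_true}$ on $\pi$ if $\pi\models\varphi$ and some $\pi'$ has $\pi\pi'\not\models\varphi$; in $\mathit{temp\_false}$ if $\pi\not\models\varphi$ and some $\pi'$ has $\pi\pi'\models\varphi$; in $\mathit{perm\_true}$ if $\pi\models\varphi$ and every $\pi'$ has $\pi\pi'\models\varphi$; in $\mathit{perm\_false}$ if $\pi\not\models\varphi$ and every $\pi'$ has $\pi\pi'\not\models\varphi$ ($\pi'$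 ranging over finite traces, including $\epsilon$). *)

(* Defs.v *)
From Stdlib Require Import Relation_Operators.
From mathcomp Require Import all_boot.

Set Implicit Arguments.
Unset Strict Implicit.
Unset Printing Implicit Defensive.

(* A letter, i.e. an element of 2^P, is a set of propositional symbols. *)
Definition trace (P : finType) : Type := seq {set P}.

Inductive prop_formula (P : finType) : Type :=
| PAtom of P
| PTrue
| PFalse
| PNot of prop_formula P
| PAnd of prop_formula P & prop_formula P
| POr of prop_formula P & prop_formula P.

Arguments PTrue {P}.
Arguments PFalse {P}.

Fixpoint prop_sat (P : finType) (a : {set P}) (phi : prop_formula P) : bool :=
  match phi with
  | PAtom p => p \in a
  | PTrue => true
  | PFalse => false
  | PNot phi1 => ~~ prop_sat a phi1
  | PAnd phi1 phi2 => prop_sat a phi1 && prop_sat a phi2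
  | POr phi1 phi2 => prop_sat a phi1 || prop_sat a phi2
  end.

Inductive ldlf (P : finType) : Type :=
| LTrue
| LFalse
| LNot of ldlf P
| LAnd of ldlf P & ldlf P
| LOr of ldlf P & ldlf P
| LDiamond of path_expr P & ldlf P
| LBox of path_expr P & ldlf P
with path_expr (P : finType) : Type :=
| EProp of prop_formula P
| ETest of ldlf P
| EPlus of path_expr P & path_expr P
| ESeq of path_expr P & path_expr P
| EStar of path_expr P.

Arguments LTrue {P}.
Arguments LFalse {P}.

(* [sat pi phi i] is "pi, i |= phi" and [match_path pi rho i j] is
   "pi(i,j) \in L(rho)"; the latter is a relation between the positions i and j
   of pi, not a property of the subtrace, because tests are evaluated in pi.
   Positions are not bounded by the length of pi. *)
Fixpoint sat (P : finType) (pi : trace P) (phi : ldlf P) (i : nat)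
    {struct phi} : Prop :=
  match phi with
  | LTrue => True
  | LFalse => False
  | LNot phi1 => ~ sat pi phi1 i
  | LAnd phi1 phi2 => sat pi phi1 i /\ sat pi phi2 i
  | LOr phi1 phi2 => sat pi phi1 i \/ sat pi phi2 i
  | LDiamond rho phi1 =>
      exists j, [/\ i <= j, match_path pi rho i j & sat pi phi1 j]
  | LBox rho phi1 =>
      forall j, i <= j -> match_path pi rho i j -> sat pi phi1 j
  end
with match_path (P : finType) (pi : trace P) (rho : path_expr P) (i j : nat)
    {struct rho} : Prop :=
  match rho with
  | EProp phi => [/\ j = i.+1, i < size pi & prop_sat (nth set0 pi i) phi]
  | ETest phi => j = i /\ sat pi phi i
  | EPlus rho1 rho2 => match_path pi rho1 i j \/ match_path pi rho2 i j
  | ESeq rho1 rho2 =>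
      exists k, match_path pi rho1 i k /\ match_path pi rho2 k j
  | EStar rho1 => clos_refl_trans_1n nat (match_path pi rho1) i j
  end.

Definition models (P : finType) (pi : trace P) (phi : ldlf P) : Prop :=
  sat pi phi 0.

Definition end_formula (P : finType) : ldlf P := LBox (EProp PTrue) LFalse.

Arguments end_formula {P}.

(* Expressions without tests; [path_of_regexp] below embeds them in [path_expr]. *)
Inductive regexp (P : finType) : Type :=
| RProp of prop_formula P
| RPlus of regexp P & regexp P
| RSeq of regexp P & regexp P
| RStar of regexp P.

Fixpoint regexp_lang (P : finType) (r : regexp P) (w : trace P) : Prop :=
  match r with
  | RProp phi => exists a : {set P}, w = [:: a] /\ prop_sat a phi
  | RPlus r1 r2 => regexp_lang r1 w \/ regexp_lang r2 w
  | RSeq r1 r2 =>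
      exists u v, [/\ w = u ++ v, regexp_lang r1 u & regexp_lang r2 v]
  | RStar r1 =>
      exists ws : seq (trace P),
        w = flatten ws /\ (forall u, u \in ws -> regexp_lang r1 u)
  end.

Fixpoint path_of_regexp (P : finType) (r : regexp P) : path_expr P :=
  match r with
  | RProp phi => EProp phi
  | RPlus r1 r2 => EPlus (path_of_regexp r1) (path_of_regexp r2)
  | RSeq r1 r2 => ESeq (path_of_regexp r1) (path_of_regexp r2)
  | RStar r1 => EStar (path_of_regexp r1)
  end.

Coercion path_of_regexp : regexp >-> path_expr.

Definition poss_good (P : finType) (phi : ldlf P) (pi : trace P) : Prop :=
  exists pi' : trace P, models (pi ++ pi') phi.

Inductive rv_state : Type := temp_true | temp_false | perm_true | perm_false.

Definition in_rv_state (P : finType) (phi : ldlf P) (pi : trace P)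
    (s : rv_state) : Prop :=
  match s with
  | temp_true =>
      models pi phi /\ exists pi' : trace P, ~ models (pi ++ pi') phi
  | temp_false =>
      ~ models pi phi /\ exists pi' : trace P, models (pi ++ pi') phi
  | perm_true =>
      models pi phi /\ forall pi' : trace P, models (pi ++ pi') phi
  | perm_false =>
      ~ models pi phi /\ forall pi' : trace P, ~ models (pi ++ pi') phi
  end.

(* Main.v *)
Require Import Defs.
From Stdlib Require Import Relation_Operators Classical_Prop.
From mathcomp Require Import all_boot.

(** The formula [<r> end] forces a match of [r] to consume the whole trace, and
    for a test-free [r] matching between two positions only depends on the
    subtrace, so [<r> end] defines exactly the language of [r]. The four
    characterisations are then propositional facts about the existence of a
    good or of a bad continuation. *)

(* Splitting the trace as [a ++ b] at the starting position restricts the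
   statement to starting positions inside the trace or at its end. *)
Lemma match_path_regexp (P : finType) (r : regexp P) (a b : trace P) (j : nat) :
  match_path (a ++ b) r (size a) j <->
  exists u v, [/\ b = u ++ v, j = size a + size u & regexp_lang r u].
Proof.
elim: r a b j => [phi|r1 IH1 r2 IH2|r1 IH1 r2 IH2|r IH] a b j /=.
- split.
    case=> ->; rewrite size_cat nth_cat ltnn subnn.
    case: b => [|c b]; first by rewrite addn0 ltnn.
    move=> _ /= Hc; exists [:: c], b; split=> //; first by rewrite addn1.
    by exists c.
  case=> u [v [-> -> [c [-> Hc]]]] /=.
  by rewrite addn1 size_cat nth_cat ltnn subnn /= -addn1 leq_add2l.
- split.
    by case=> [/IH1|/IH2] [u [v [-> -> Hu]]]; exists u, v; split; auto.
  case=> u [v [-> -> [Hu|Hu]]]; [left; apply/IH1|right; apply/IH2];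
    by exists u, v.
- split.
    case=> k [/IH1 [u [v [-> -> Hu]]]].
    (* Regrouping as [(a ++ u) ++ v] makes the intermediate position the size of a prefix, the form
       that the second induction hypothesis requires. *)
    rewrite catA -size_cat => /IH2 [u' [v' [-> -> Hu']]].
    exists (u ++ u'), v'; split; rewrite ?catA ?size_cat ?addnA //.
    by exists u, u'.
  case=> _ [v [-> -> [u [u' [-> Hu Hu']]]]].
  exists (size a + size u); split.
    by apply/IH1; exists u, (u' ++ v); rewrite catA.
  rewrite -catA catA size_cat addnA -size_cat.
  by apply/IH2; exists u', v; rewrite size_cat.
- split.
    (* Equations tie the trace and the start to [a] and [b], so that induction along the closure can
       move each matched factor from [b] to the end of [a]. *)
    move Epi: (a ++ b) => pi; move Ei: (size a) => i Hstar.
    elim: Hstar a b Epi Ei => [x|x y z Hxy _ IHs] a b pi_ab x_a.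
      exists [::], b; split=> //; first by rewrite addn0.
      by exists [::].
    move: Hxy; rewrite -pi_ab -x_a => /IH [u [v [b_uv y_au Hu]]].
    have auv_pi : (a ++ u) ++ v = pi by rewrite -catA -b_uv.
    have size_au : size (a ++ u) = y by rewrite size_cat -y_au.
    have [u' [v' [v_uv z_au [ws [u_ws Hws]]]]] := IHs _ _ auv_pi size_au.
    exists (u ++ u'), v'; split; rewrite ?b_uv ?v_uv ?catA //.
      by rewrite z_au y_au size_cat addnA.
    exists (u :: ws); split; first by rewrite u_ws.
    by move=> t; rewrite inE => /predU1P [->|/Hws].
  case=> _ [v [-> -> [ws [-> Hws]]]].
  (* With [a] general, the first factor [w] is absorbed into the prefix and the remaining ones start
     at [size (a ++ w)]. *)
  elim: ws a Hws => [|w ws IHws] a Hws /=.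
    by rewrite addn0; apply: rt1n_refl.
  apply: (@Relation_Operators.rt1n_trans _ _ _ (size (a ++ w))).
    apply/IH; exists w, (flatten ws ++ v); rewrite catA size_cat.
    by split=> //; apply: Hws; rewrite mem_head.
  rewrite -catA catA [X in clos_refl_trans_1n _ _ _ X]
    (_ : _ = size (a ++ w) + size (flatten ws)); last first.
    by rewrite !size_cat addnA.
  by apply: IHws => t t_ws; apply: Hws; rewrite inE t_ws orbT.
Qed.

(** The box is vacuous exactly when no letter stands at position [i]; positions are unbounded, hence
    an inequality. *)
Lemma sat_end_formula (P : finType) (pi : trace P) (i : nat) :
  sat pi end_formula i <-> size pi <= i.
Proof.
split=> [Hend|le_pi_i j _ /= [_]]; last by rewrite ltnNge le_pi_i.
by rewrite leqNgt; apply/negP => lt_i_pi; apply: (Hend i.+1).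
Qed.

Lemma models_diamond_end (P : finType) (r : regexp P) (pi : trace P) :
  models pi (LDiamond r end_formula) <-> regexp_lang r pi.
Proof.
split.
  case=> j [_ /(match_path_regexp _ r [::] pi) [u [v [-> -> Hu]]]].
  (* The match stops at [size u], so the end condition bounds [size (u ++ v)] by [size u] and [v] is
     empty. *)
  move/sat_end_formula; rewrite size_cat add0n -[X in _ <= X]addn0 leq_add2l.
  by rewrite leqn0 => /nilP ->; rewrite cats0.
move=> Hpi; exists (size pi); split=> //; last exact/sat_end_formula.
by apply/(match_path_regexp _ r [::] pi); exists pi, [::]; rewrite cats0.
Qed.

Lemma models_poss_good (P : finType) (phi : ldlf P) (pi : trace P) :
  models pi phi -> poss_good phi pi.
Proof. by exists [::]; rewrite cats0. Qed.

Lemma not_poss_good_not (P : finType) (phi : ldlf P) (pi : trace P) :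
  ~ poss_good (LNot phi) pi <-> forall pi' : trace P, models (pi ++ pi') phi.
Proof.
split=> [Hn pi'|Hall [pi' Hpi']]; last exact: Hpi' (Hall pi').
(* The absence of a bad continuation yields only a double negation, which classical logic
   removes. *)
by apply: NNPP => Hpi'; apply: Hn; exists pi'.
Qed.

Theorem theorem3 (P : finType) (phi : ldlf P) (pref_phi pref_nphi : regexp P)
    (Hpref : forall pi : trace P, regexp_lang pref_phi pi <-> poss_good phi pi)
    (Hnpref : forall pi : trace P,
        regexp_lang pref_nphi pi <-> poss_good (LNot phi) pi)
    (pi : trace P) :
  (in_rv_state phi pi temp_true <->
     models pi (LAnd phi (LDiamond pref_nphi end_formula))) /\
  (in_rv_state phi pi temp_false <->
     models pi (LAnd (LNot phi) (LDiamond pref_phi end_formula))) /\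
  (in_rv_state phi pi perm_true <->
     models pi (LAnd (LDiamond pref_phi end_formula)
                     (LNot (LDiamond pref_nphi end_formula)))) /\
  (in_rv_state phi pi perm_false <->
     models pi (LAnd (LDiamond pref_nphi end_formula)
                     (LNot (LDiamond pref_phi end_formula)))).
Proof.
have modelsAnd f g : models pi (LAnd f g) <-> models pi f /\ models pi g by [].
have modelsNot f : models pi (LNot f) <-> ~ models pi f by [].
have Hgood : models pi (LDiamond pref_phi end_formula) <-> poss_good phi pi.
  exact: iff_trans (models_diamond_end _ _ _) (Hpref pi).
have Hbad : models pi (LDiamond pref_nphi end_formula)
    <-> poss_good (LNot phi) pi.
  exact: iff_trans (models_diamond_end _ _ _) (Hnpref pi).
have good := models_poss_good _ phi pi.
have bad := models_poss_good _ (LNot phi) pi.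
have all_good := not_poss_good_not _ phi pi.
have all_bad : ~ poss_good phi pi <-> forall pi', ~ models (pi ++ pi') phi.
  by split=> [Hn pi' ?|Hall [pi' /Hall]] //; apply: Hn; exists pi'.
(* For [perm_true], [poss_good phi pi] does not give [models pi phi]; the empty continuation
   does. *)
have nil_good : (forall pi', models (pi ++ pi') phi) -> models pi phi.
  by move/(_ [::]); rewrite cats0.
(* A continuation violating [phi] is by definition one satisfying [LNot phi]. *)
have ex_bad : (exists pi', ~ models (pi ++ pi') phi)
    <-> poss_good (LNot phi) pi by [].
have ex_good : (exists pi', models (pi ++ pi') phi) <-> poss_good phi pi by [].
rewrite /in_rv_state !modelsAnd !modelsNot Hgood Hbad.
tauto.
Qed.
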